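(* Let $G$ be a simple $r$-graph on vertex set $[n]$, with at least one edge, for which the degree sequence is decreasing, that is, $d(1)\ge d(2)\ge\cdots\ge d(n)$. Let $0<\zeta\le 1/(12\,r!)$ and $\tau>0$. Suppose that $\delta(G,\tau)\le\zeta$, that $\tau\le\zeta^2/r$, and that $k\in[n]$ satisfies $\mu([k])\le\zeta/(2\,r!)$. Let $t\in\mathbb{N}$. Then there exists a collection $\mathcal{C}\subset\mathcal{P}([n])$ and a map $g:\mathcal{C}^t\to[k,n]$ with the following properties: (a) for all independent sets $I$ there is some $C\in\mathcal{C}$ with $I\subset C$, (b) for all $v\in[n]$, $$\log\big|\{(C_1\cap[v],\ldots,C_t\cap[v]): (C_1,\ldots,C_t)\in\mathcal C^t,\ g(C_1,\ldots,C_t)=v\}\big|\le r\zeta^{-2}vt\tau\log(1/\tau),$$ (c) for all $(C_1,\ldots,C_t)\in\mathcal{C}^t$, $$\frac1t\sum_{i=1}^t|C_i\cap[v]|\le\Big(1-\frac1{r!}+8\zeta\Big)v,\qquad\text{where } v=g(C_1,\ldots,C_t).$$ Moreover, (a) holds for all sets $I\subset[n]$ for which either $G[I]$ is $\lfloor\tau^{r-1}\zeta e(G)/n\rfloor$-degenerate or $e(G[I])\le 2r\tau^re(G)/\zeta$.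
   Context: An $r$-graph is an $r$-uniform hypergraph $G=(V(G),E(G))$; $e(G)=|E(G)|$; $G[S]$ is the subhypergraph induced by $S\subset V(G)$; $\mathcal{P}(S)$ is the set of subsets of $S$; $[n]=\{1,\ldots,n\}$ and $[k,n]=\{k,\ldots,n\}$. A set $I\subset V(G)$ is independent if no edge is contained in $I$. $G$ is simple if every pair of vertices lies in at most one edge. An $r$-graph $F$ is $b$-degenerate if $e(F[S])\le b|S|$ for every $S\subset V(F)$. The logarithm of $0$ (empty set in (b)) is read as $-\infty$. For $\sigma\subset V(G)$, $d(\sigma)$ is the number of edges containing $\sigma$, and $d(v)=d(\{v\})$. Let $G$ have order $n$ and average degree $d$. Degree measure: for $S\subset V(G)$, $\mu(S)=\frac{1}{nd}\sum_{u\in S}d(u)$. Co-degree function: for $v\in V(G)$ and $2\le j\le r$ let $d^{(j)}(v)=\max\{d(\sigma): v\in\sigma\subset V(G),\ |\sigma|=j\}$. For $d>0$, define $\delta_j$ by $\delta_j\,\tau^{j-1}nd=\sum_v d^{(j)}(v)$, and $$\delta(G,\tau)=2^{\binom r2-1}\sum_{j=2}^r2^{-\binom{j-1}{2}}\delta_j .$$ *)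

(* Defs.v *)
From HB Require Import structures.
From mathcomp Require Import all_boot all_order all_algebra.
From mathcomp Require Import reals ereal exp.
Set Implicit Arguments.
Unset Strict Implicit.
Unset Printing Implicit Defensive.
Import Order.TTheory GRing.Theory Num.Theory.
Local Open Scope ring_scope.

(* The vertex set is a field of the record, rather than the whole type, so that
   the subhypergraph induced by S really has vertex set S. *)
Record hypergraph (T : finType) (r : nat) := Hypergraph {
  vertices : {set T};
  edges : {set {set T}};
  edges_sub : forall e, e \in edges -> e \subset vertices;
  edges_card : forall e, e \in edges -> #|e| = r }.

Section Notions.
Variables (T : finType) (r : nat).
Implicit Types (G F : hypergraph T r) (S I s : {set T}) (u v : T).

Definition num_vertices G : nat := #|vertices G|.

Definition num_edges G : nat := #|edges G|.

Definition ind_edges G S : {set {set T}} := [set e in edges G | e \subset S].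

Fact ind_edges_sub G S e : e \in ind_edges G S -> e \subset vertices G :&: S.
Proof. by rewrite inE subsetI => /andP[/edges_sub -> ->]. Qed.

Fact ind_edges_card G S e : e \in ind_edges G S -> #|e| = r.
Proof. by rewrite inE => /andP[/edges_card]. Qed.

Definition induced G S : hypergraph T r :=
  Hypergraph (@ind_edges_sub G S) (@ind_edges_card G S).

Definition independent G I : Prop :=
  I \subset vertices G /\ forall e, e \in edges G -> ~~ (e \subset I).

Definition codeg G s : nat := #|[set e in edges G | s \subset e]|.

Definition deg G v : nat := codeg G [set v].

Definition simple_graph G : Prop :=
  forall u v, u \in vertices G -> v \in vertices G -> u != v ->
    (codeg G [set u; v] <= 1)%N.

Definition codegj G (j : nat) v : nat :=
  (\max_(s : {set T} | [&& s \subset vertices G, v \in s & #|s| == j])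
     codeg G s)%N.

Section Real.
Variable R : realType.
Implicit Types (tau b : R).

Definition degenerate F b : Prop :=
  forall S, S \subset vertices F ->
    (num_edges (induced F S))%:R <= b * #|S|%:R.

Definition avg_deg G : R :=
  (\sum_(v in vertices G) (deg G v)%:R) / (num_vertices G)%:R.

Definition deg_measure G S : R :=
  ((num_vertices G)%:R * avg_deg G)^-1 * \sum_(u in S) (deg G u)%:R.

(* delta_j is obtained by solving delta_j tau^(j-1) n d = sum_v d^(j)(v), so it
   is meaningful only for tau > 0 and positive average degree d. *)
Definition deltaj G tau (j : nat) : R :=
  (\sum_(v in vertices G) (codegj G j v)%:R) /
  (tau ^+ j.-1 * (num_vertices G)%:R * avg_deg G).

(* The first exponent is an integer, since it is -1 when r = 1. *)
Definition codeg_fun G tau : R :=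
  2 ^ ('C(r, 2)%:Z - 1) *
  \sum_(2 <= j < r.+1) 2 ^- 'C(j.-1, 2) * deltaj G tau j.

End Real.
End Notions.

(* The vertex i of [n] = {1, ..., n} is encoded as the ordinal of value i - 1,
   so that [v] consists of the ordinals of value less than v. *)
Definition initseg (n v : nat) : {set 'I_n} := [set i : 'I_n | (i < v)%N].

Definition in_power (n t : nat) (C : {set {set 'I_n}})
    (Cs : t.-tuple {set 'I_n}) : bool :=
  [forall i : 'I_t, tnth Cs i \in C].

(* Only the values of g on t-tuples of elements of C matter, so g is total. *)
Definition traces (n t : nat) (C : {set {set 'I_n}})
    (g : t.-tuple {set 'I_n} -> nat) (v : nat) : {set t.-tuple {set 'I_n}} :=
  [set map_tuple (fun D => D :&: initseg n v) Cs
    | Cs : t.-tuple {set 'I_n} & in_power C Cs && (g Cs == v)].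

(* Main.v *)
Require Import Defs.
From mathcomp Require Import all_boot all_order all_algebra.
From mathcomp Require Import reals ereal sequences exp.
From mathcomp Require Import zify ring lra.
Set Implicit Arguments.
Unset Strict Implicit.
Unset Printing Implicit Defensive.
Import Order.TTheory GRing.Theory Num.Theory.
Local Open Scope ring_scope.

(** A container of I is built by scanning the vertices in increasing order while
    keeping, for every level s < r, a set P_s of active edges. An edge of P_s is
    an edge of G whose first r - s vertices have been selected; what remains is
    its tail, the last s vertices. At level r every edge is active. When v is
    scanned, its link at level s consists of the edges of P_(s+1) whose tail
    starts at v and whose other tail vertices are unsaturated, that is, lie in
    the tails of fewer than tau^(r-s) d(u) edges of P_s. If this link is large
    compared with d(v), and d(v) is at least zeta times the average degree d,
    then v is heavy; a heavy v in I enters the fingerprint T_s, and its link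
    joins P_s. A heavy vertex outside I is thrown out, and the container of I
    consists of I and of all vertices that are never heavy.

    Fingerprints are small: for s > 0 each vertex of T_s brings at least zeta
    tau^(r-s-1) d(v) new edges into P_s, whereas saturation and simplicity keep
    every degree in P_s below tau^(r-s) d(u) + 1; the hypothesis on delta says
    that the terms +1 are negligible. So T_s has degree measure at most 2 tau /
    zeta for s > 0 ([fingerprint_volume_pos]). At level 0 a completed edge lies
    inside I, so the few edges of G[I], or its degeneracy, give the same bound
    ([small_fingerprint_sparse], [small_fingerprint_degenerate]).

    Containers are small: let Z consist of the heavy vertices and of the
    vertices of degree below zeta d. Up to few edges, every tail of P_(s+1)
    meets Z or the set U_s of vertices saturated at level s. Hence the vertices
    of U_(s+1) missed by Z and U_s are paid for by those two sets, each edge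
    contributing at most s missed vertices for each vertex that is hit, and the
    measure y_s of Z and U_s together satisfies y_(s+1) <= (s+1) y_s + O(zeta)
    ([volume_cover_succ]). Vertices saturated at level 1 are heavy at level 0 or
    of small degree, so y_1 is the measure of Z, while U_r is everything, so y_r
    = 1. Thus Z has measure at least 1/r! - 3 zeta ([volume_exceptional]), and
    all of Z but the vertices of small degree and the fingerprints lies outside
    the container ([volume_container]).

    The scan is online: the part of the container below v depends only on the
    part of the fingerprints below v ([container_online]). It remains to pass
    from degree measure to densities on an initial segment. Since degrees
    decrease, summation by parts writes the degree measure as a nonnegative
    combination of the counts on initial segments, so one averaging over the
    segments yields a single v, the value of g, on which the densities are
    controlled by the measures: for the t containers up to a loss of 2 zeta, and
    for their fingerprints up to a factor 1 / (2 zeta) ([exists_light_prefix]).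
    The number of traces with g = v is then at most the number of sparse
    fingerprint codes, which is counted by [ln_card_light_sets]. *)

(** * Counting sparse families and images *)

Lemma sum_subsets_exprn (R : comNzRingType) (K : finType) (W : {set K}) (y : R) :
  \sum_(S : {set K} | S \subset W) y ^+ #|S| = (1 + y) ^+ #|W|.
Proof.
have -> : (1 + y) ^+ #|W| = \prod_i ((if i \in W then y else 0) + 1).
  rewrite -prodr_const big_mkcond /=; apply: eq_bigr => i _.
  by case: ifP; rewrite addrC // addr0.
rewrite bigA_distr [LHS]big_mkcond; apply: eq_bigr => /= S _.
case: ifPn => [/subsetP sSW | /subsetPn[i iS iW]]; last first.
  by rewrite (bigD1 i) //= iS (negPf iW) mul0r.
rewrite -prodr_const big_mkcond; apply: eq_bigr => i _.
by case: ifP => // /sSW ->.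
Qed.

(** Weighting each set S by y^#|S| makes all subsets of W weigh (1 + y)^#|W| in
    total, and each member of A weighs at least y^m because y <= 1. *)
Lemma ln_card_light_sets (R : realType) (K : finType) (W : {set K})
    (A : {set {set K}}) (y m : R) :
  0 < y -> y <= 1 -> (0 < #|A|)%N ->
  (forall S, S \in A -> S \subset W /\ #|S|%:R <= m) ->
  ln (#|A|%:R : R) <= m * ln (1 / y) + y * #|W|%:R.
Proof.
move=> y0 y1 A0 HA.
rewrite -ler_expR lnK ?posrE ?ltr0n // expRD -ler_pdivrMl ?expR_gt0 //.
rewrite -expRN div1r lnV ?posrE // mulrN opprK.
apply: (@le_trans _ _ (\sum_(S in A) y ^+ #|S|)).
  rewrite -sum1_card natr_sum mulr_sumr; apply: ler_sum => S /HA[_ Sm].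
  rewrite mulr1 -[X in _ <= X ^+ _](@lnK R) ?posrE // -expRM_natl ler_expR.
  by rewrite ler_wnM2r // ln_le0.
apply: (@le_trans _ _ ((1 + y) ^+ #|W|)).
  rewrite -sum_subsets_exprn [leLHS]big_mkcond [leRHS]big_mkcond.
  apply: ler_sum => S _; case: ifP => [/HA[-> //]|_].
  by case: ifP => // _; rewrite exprn_ge0 // ltW.
rewrite mulrC expRM_natl lerXn2r ?nnegrE ?expR_ge1Dx ?expR_ge0 //.
by rewrite addr_ge0 // ltW.
Qed.

(** Used to bound the number of container traces by the number of fingerprint
    traces that determine them. *)
Lemma card_imset_factor (aT rT sT : finType) (f : aT -> rT) (h : aT -> sT)
    (A : {set aT}) :
  {in A &, forall x y, h x = h y -> f x = f y} ->
  (#|f @: A| <= #|h @: A|)%N.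
Proof.
move=> fh; pose F s := [pick x in A | h x == s].
have [->|[x0 x0A]] := set_0Vmem A; first by rewrite !imset0 !cards0.
pose g s := odflt (f x0) (omap f (F s)).
suff -> : f @: A = g @: (h @: A) by apply: leq_imset_card.
rewrite -imset_comp; apply: eq_in_imset => x xA /=.
rewrite /g /F; case: pickP => [y /andP[yA /eqP/esym hxy]|/(_ x)] /=.
  exact: fh.
by rewrite xA eqxx.
Qed.

(** * Initial segments and summation by parts *)

Lemma card_initseg n v : (v <= n)%N -> #|initseg n v| = v.
Proof.
move=> vn; rewrite /initseg -sum1_card.
rewrite (eq_bigl (fun i : 'I_n => i < v)%N) => [|i]; last by rewrite inE.
by rewrite -(big_ord_widen _ (fun=> 1%N)) // sum1_card card_ord.
Qed.

(** F u is the telescoping sum of the differences F i - F (i+1) over i >= u, that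
    is, over the initial segments that contain u. *)
Lemma sum_by_parts_initseg (R : pzRingType) (n : nat) (F : nat -> R)
    (S : {set 'I_n}) :
  F n = 0 ->
  \sum_(u in S) F u =
  \sum_(0 <= i < n) (F i - F i.+1) * #|S :&: initseg n i.+1|%:R.
Proof.
move=> Fn0; under [RHS]eq_bigr => i _.
  have -> : #|S :&: initseg n i.+1|%:R = \sum_(u in S) (u <= i)%N%:R :> R.
    rewrite -sum1_card natr_sum big_mkcond [RHS]big_mkcond /=.
    by apply: eq_bigr => u _; rewrite !inE ltnS; do 2!case: ifP => //=;
       case: (u <= i)%N => //; case: (u \in S).
  rewrite mulr_sumr; over.
rewrite exchange_big; apply: eq_bigr => u _ /=.
rewrite (big_cat_nat (n:=u)) //=; last exact: ltnW.
rewrite big_nat_cond big1 ?add0r; last first.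
  by move=> i /andP[/andP[_ iu] _]; rewrite leqNgt iu mulr0.
transitivity (\sum_(u <= i < n) (F i - F i.+1)).
  have := telescope_sumr F (ltnW (ltn_ord u)); rewrite Fn0 sub0r => /(congr1 -%R).
  rewrite opprK => <-; rewrite -sumrN; apply: eq_bigr => i _; exact: opprB.
by apply: eq_big_nat => i /andP[-> _]; rewrite mulr1.
Qed.

(** An index violating one of the two bounds has h1 i / a + h2 i / b above i + 1.
    Normalising both functions and adding them costs less than excluding the
    indices that are bad for h1 and for h2 by two successive averagings. *)
Lemma exists_light_index (R : realFieldType) (k n : nat) (w h1 h2 : nat -> R)
    (a b : R) :
  0 < a -> 0 < b ->
  (forall i, (i < n)%N -> [/\ 0 <= w i, 0 <= h1 i & 0 <= h2 i]) ->
  \sum_(0 <= i < n) w i * (h1 i / a + h2 i / b) <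
    \sum_(k <= i < n) w i * i.+1%:R ->
  exists i, [/\ (k <= i < n)%N, h1 i <= a * i.+1%:R & h2 i <= b * i.+1%:R].
Proof.
move=> a0 b0 pos lt.
have [/existsP[i /and3P[]]|] :=
  boolP [exists i : 'I_n, [&& (k <= i)%N, h1 i <= a * i.+1%:R & h2 i <= b * i.+1%:R]].
  by exists i; split; rewrite ?ltn_ord ?andbT.
rewrite negb_exists => /forallP H.
suff : \sum_(k <= i < n) w i * i.+1%:R <=
       \sum_(0 <= i < n) w i * (h1 i / a + h2 i / b).
  by rewrite leNgt lt.
have term i : (i < n)%N -> 0 <= w i * (h1 i / a + h2 i / b).
  move=> /pos[w0 h10 h20].
  by rewrite mulr_ge0 // addr_ge0 // divr_ge0 // ltW.
have [nk|kn] := leqP n k.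
  by rewrite big_geq // big_nat sumr_ge0 // => i /andP[_]; apply: term.
rewrite [leRHS](big_cat_nat (n:=k)) //=; last exact: ltnW.
rewrite -[leLHS]add0r; apply: lerD.
  rewrite big_nat sumr_ge0 // => i /andP[_ ik]; apply: term.
  exact: ltn_trans ik kn.
apply: ler_sum_nat => i /andP[ki ik]; have [w0 h10 h20] := pos i ik.
apply: ler_wpM2l => //.
have := H (Ordinal ik); rewrite /= ki /= negb_and -!ltNge => /orP[] lt1.
  rewrite -[leLHS]addr0; apply: lerD; last by rewrite divr_ge0 // ltW.
  by rewrite ler_pdivlMr // mulrC ltW.
rewrite -[leLHS]add0r; apply: lerD; first by rewrite divr_ge0 // ltW.
by rewrite ler_pdivlMr // mulrC ltW.
Qed.

(** * Ranks of the vertices of an edge *)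

Section Rank.
Variable n : nat.
Implicit Types (e : {set 'I_n}) (u v : 'I_n).

Definition rank e u : nat := #|[set w in e | (w < u)%N]|.

Definition tail s e : {set 'I_n} := [set u in e | (#|e| <= rank e u + s)%N].

Lemma rank_lt_card e u : u \in e -> (rank e u < #|e|)%N.
Proof.
move=> ue; apply: proper_card; apply/properP; split.
  by apply/subsetP => w; rewrite inE => /andP[].
by exists u; rewrite // inE ltnn andbF.
Qed.

Lemma rank_homo e u v : u \in e -> (u < v)%N -> (rank e u < rank e v)%N.
Proof.
move=> ue uv; apply: proper_card; apply/properP; split.
  by apply/subsetP => w; rewrite !inE => /andP[-> /ltn_trans->].
by exists u; rewrite !inE ue // ltnn.
Qed.

Lemma ltn_rank e u v : (rank e u < rank e v)%N -> (u < v)%N.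
Proof.
apply: contraTT; rewrite -!leqNgt => vu; apply: subset_leq_card.
by apply/subsetP => w; rewrite !inE => /andP[-> /leq_trans->].
Qed.

Lemma rank_inj e : {in e &, injective (rank e)}.
Proof.
move=> u v ue ve eq; apply: val_inj.
case: (ltngtP (val u) (val v)) => // lt.
  by have := rank_homo ue lt; rewrite eq ltnn.
by have := rank_homo ve lt; rewrite eq ltnn.
Qed.

(** The rank is a bijection from e to the numbers below #|e|. *)
Lemma card_rank_preim e (P : pred nat) :
  #|[set u in e | P (rank e u)]| = #|[set i : 'I_#|e| | P i]|.
Proof.
case: (set_0Vmem e) => [e0|[u0 u0e]].
  have c0 : #|e| = 0%N by rewrite e0 cards0.
  rewrite [LHS]eq_card0 => [|x]; last by rewrite inE [in x \in _]e0 inE.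
  by rewrite [RHS]eq_card0 // => x; have := leq_trans (ltn_ord x) (eq_leq c0).
have e_gt0 : (0 < #|e|)%N by apply/card_gt0P; exists u0.
pose rk u : 'I_#|e| := insubd (Ordinal e_gt0) (rank e u).
have rkE u : u \in e -> rk u = rank e u :> nat.
  by move=> ue; rewrite val_insubd rank_lt_card.
have rk_inj : {in e &, injective rk}.
  by move=> u v ue ve /(congr1 val) /=; rewrite !rkE //; apply: rank_inj.
have im : rk @: e = [set: 'I_#|e|].
  by apply/eqP; rewrite eqEcard subsetT cardsT card_ord (card_in_imset rk_inj) /=.
have inj : {in [set u in e | P (rank e u)] &, injective rk}.
  move=> u v; rewrite !inE => /andP[ue _] /andP[ve _].
  exact: rk_inj.
rewrite -(card_in_imset inj).
apply: eq_card => i; rewrite inE; apply/imsetP/idP => [[u]|Pi].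
  by rewrite inE => /andP[ue Pu] ->; rewrite rkE.
have : i \in rk @: e by rewrite im.
by case/imsetP => u ue iE; exists u => //; rewrite inE ue -rkE // -iE.
Qed.

Lemma card_tail s e : (s <= #|e|)%N -> #|tail s e| = s.
Proof.
move=> se; rewrite (card_rank_preim e (fun i => #|e| <= i + s)%N).
rewrite (_ : [set _ | _] = ~: [set i : 'I_#|e| | (i < #|e| - s)%N]); last first.
  by apply/setP => i; rewrite !inE; lia.
rewrite cardsCs setCK card_ord.
suff -> : #|[set i : 'I_#|e| | (i < #|e| - s)%N]| = (#|e| - s)%N by lia.
rewrite -sum1_card (eq_bigl (fun i : 'I__ => i < #|e| - s)%N) => [|i]; last first.
  by rewrite inE.
by rewrite -(big_ord_widen _ (fun=> 1%N)) ?leq_subr // sum1_card card_ord.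
Qed.

Lemma exists_rank e i : (i < #|e|)%N -> exists2 u, u \in e & rank e u = i.
Proof.
move=> ie; have : (0 < #|[set u in e | rank e u == i]|)%N.
  rewrite (card_rank_preim e (pred1 i)); apply/card_gt0P.
  by exists (Ordinal ie); rewrite inE /=.
by case/card_gt0P => u; rewrite inE => /andP[ue /eqP]; exists u.
Qed.

End Rank.

(** * The scanning algorithm *)

Section Algorithm.
Variables (R : realType) (n r : nat) (G : hypergraph 'I_n r) (zeta tau : R).
Implicit Types (P Q : {set {set 'I_n}}) (I S : {set 'I_n}) (s m : nat) (u v : 'I_n).

Definition tail_deg P s u : nat := #|[set e in P | u \in tail s e]|.

Definition saturated P s u : bool :=
  tau ^+ (r - s) * (deg G u)%:R <= (tail_deg P s u)%:R.

(** In [link], P plays the part of level s and Q of level s + 1.  The universal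
    condition is void for s = 0, when the tail is empty. *)
Definition link Q P s v : {set {set 'I_n}} :=
  [set e in Q | [&& v \in e, (rank e v + s.+1 == r)%N &
                    [forall u in tail s e, ~~ saturated P s u]]].

(** At level 0 the factor zeta is absent: a vertex has to be saturated at level 1
    to be heavy there.  This is what makes fingerprints of sparse sets small. *)
Definition threshold s : R := (if s == 0%N then 1 else zeta) * tau ^+ (r - s.+1).

(** Vertices of degree below zeta times the average are never heavy, which bounds
    the cardinality of a fingerprint, and not only its degree sum. *)
Definition heavy_link Q P s v : bool :=
  (zeta * avg_deg R G <= (deg G v)%:R) &&
  (threshold s * (deg G v)%:R <= #|link Q P s v|%:R).

(** [active I m s] is P_s after the vertices below m have been scanned.  At most
    one v contributes to the union, which lets m run over all of nat. *)
Fixpoint active I m s : {set {set 'I_n}} :=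
  if m is m'.+1 then
    active I m' s :|:
    \bigcup_(v : 'I_n | [&& val v == m', v \in I &
                         heavy_link (active I m' s.+1) (active I m' s) s v])
      link (active I m' s.+1) (active I m' s) s v
  else if s == r then edges G else set0.

Definition new_edges I s v := link (active I v s.+1) (active I v s) s v.

Definition heavy I s v := heavy_link (active I v s.+1) (active I v s) s v.

Definition fingerprint I s : {set 'I_n} := [set v in I | heavy I s v].

Definition container I : {set 'I_n} :=
  I :|: [set v | [forall s : 'I_r, ~~ heavy I s v]].

Lemma sub_container I : I \subset container I.
Proof. exact: subsetUl. Qed.

Lemma active_succ I s (v : 'I_n) :
  active I v.+1 s =
  active I v s :|: (if v \in fingerprint I s then new_edges I s v else set0).
Proof.
rewrite /=; congr (_ :|: _); rewrite inE.
rewrite big_mkcond (bigD1 v) //= eqxx /= big1 ?setU0 // => w wv.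
by rewrite (_ : (val w == v) = false) //; apply: negbTE.
Qed.

Lemma active_mono I s m m' : (m <= m')%N -> active I m s \subset active I m' s.
Proof.
move=> /subnK<-; elim: (m' - m)%N => [//|k IH].
by rewrite addSn /=; apply: subset_trans IH (subsetUl _ _).
Qed.

Lemma in_active I s m e : (s < r)%N -> e \in active I m s ->
  exists v, [/\ (v < m)%N, v \in fingerprint I s & e \in new_edges I s v].
Proof.
move=> sr; elim: m => [|m IH] /=; first by rewrite ltn_eqF // inE.
rewrite inE => /orP[/IH[v [vm vT ev]]|].
  by exists v; split => //; apply: ltnW.
case/bigcupP => v /and3P[/eqP vm vI hv] ev; exists v.
by subst m; rewrite ltnS leqnn inE vI.
Qed.

Lemma active_sub_edges I s m : active I m s \subset edges G.
Proof.
elim: m s => [|m IH] s /=; first by case: ifP; rewrite ?sub0set.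
rewrite subUset IH /=; apply/bigcupsP => v _; apply/subsetP => e.
by rewrite inE => /andP[/(subsetP (IH _))].
Qed.

Lemma active_top I m : active I m r = edges G.
Proof.
elim: m => [|m IH] /=; first by rewrite eqxx.
rewrite IH big1 ?setU0 // => v _; apply/setP => e; rewrite !inE.
by rewrite (_ : (_ + r.+1 == r)%N = false) ?andbF //; lia.
Qed.

Lemma card_active I m s e : e \in active I m s -> #|e| = r.
Proof. by move/(subsetP (active_sub_edges _ _ _))/edges_card. Qed.

(** An edge enters level s + 1 while a vertex preceding its tail is scanned, so it
    is already there when the first vertex of the tail is reached. *)
Lemma active_at_head I s m e v : e \in active I m s.+1 -> v \in e ->
  (rank e v + s.+1 = r)%N -> e \in active I v s.+1.
Proof.
move=> em ve rk; have [sr|rs] := ltnP s.+1 r; last first.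
  have -> : s.+1 = r by lia.
  by rewrite active_top (subsetP (active_sub_edges I s.+1 m)).
have [w [_ wT ew]] := in_active sr em.
have wv : (w < v)%N.
  by move: ew; rewrite inE => /and4P[_ _ /eqP rkw _]; apply: (@ltn_rank _ e); lia.
have : e \in active I w.+1 s.+1 by rewrite active_succ wT inE ew orbT.
exact/subsetP/active_mono.
Qed.

Lemma fingerprint_sub I s : fingerprint I s \subset I.
Proof. by apply/subsetP => v; rewrite inE => /andP[]. Qed.

(** A vertex that has left the tail of an active edge was selected at the level
    at which it was the first vertex of the tail. *)
Lemma active_head_fingerprint I m s e v : e \in active I m s -> v \in e ->
  (rank e v + s < r)%N -> v \in fingerprint I (r - (rank e v).+1).
Proof.
move E: (r - s)%N => k; elim: k m s E => [|k IH] m s E em ve rk; first lia.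
have [w [_ wT]] := in_active (ltac:(lia) : (s < r)%N) em.
rewrite inE => /and4P[ew we /eqP rkw _].
have [rks|rks] := eqVneq (rank e v).+1 (r - s)%N; last by apply: (IH w s.+1) => //; lia.
have -> : v = w by apply: (rank_inj ve we); lia.
by have -> : (r - (rank e w).+1 = s)%N by lia.
Qed.

(** Through this inclusion sparseness of G[I] enters: the edges completed at level
    0 consist of fingerprint vertices, hence lie inside I. *)
Lemma active0_sub I m e : e \in active I m 0 ->
  e \subset \bigcup_(s < r) fingerprint I s.
Proof.
move=> em; have ec := card_active em; apply/subsetP => v ve.
have rk := rank_lt_card ve; rewrite ec in rk.
have vT := active_head_fingerprint em ve (ltac:(lia)).
have sr : (r - (rank e v).+1 < r)%N by lia.
by apply/bigcupP; exists (Ordinal sr).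
Qed.

(** The links released at level s are disjoint, since an edge of such a link
    determines its scanned vertex as the one of rank r - s - 1. *)
Lemma sum_new_edges_le I s :
  (s < r)%N ->
  (\sum_(v in fingerprint I s) #|new_edges I s v| <= #|active I n s|)%N.
Proof.
move=> sr; rewrite (eq_bigr (fun v => \sum_(e in new_edges I s v) 1)%N); last first.
  by move=> v _; rewrite sum1_card.
under eq_bigr do rewrite big_mkcond /=.
rewrite exchange_big -sum1_card [leqRHS]big_mkcond; apply: leq_sum => e _ /=.
have [eF|eNF] := boolP (e \in active I n s).
  have [w [_ wT]] := in_active sr eF; rewrite inE => /and4P[_ we /eqP rkw _].
  rewrite (bigD1 w wT) /= big1 => [|v /andP[_ vw]]; first by rewrite addn0; case: ifP.
  case: ifP => //; rewrite inE => /and4P[_ ve /eqP rkv _]; case/eqP: vw.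
  by apply: (rank_inj ve we); lia.
rewrite big1 // => v vT; case: ifP => // eN; case/negP: eNF.
apply: (subsetP (active_mono I s (ltn_ord v))).
by rewrite active_succ vT inE eN orbT.
Qed.

(** The state of the scan at time v is a function of the fingerprints below v: the
    set I is consulted only through the choice of the fingerprints. *)
Lemma active_online I J (v : nat) :
  (forall s (u : 'I_n), (s < r)%N -> (u < v)%N ->
     (u \in fingerprint I s) = (u \in fingerprint J s)) ->
  forall m, (m <= v)%N -> (m <= n)%N -> forall s, active I m s = active J m s.
Proof.
move=> IJ; elim=> [//|m IH] mv mn s.
have eqm := IH (ltnW mv) (ltnW mn).
pose u : 'I_n := Ordinal mn.
rewrite -[m]/(val u) !active_succ !eqm.
have eqN : new_edges I s u = new_edges J s u by rewrite /new_edges !eqm.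
have [sr|rs] := ltnP s r; first by rewrite IJ // eqN.
have N0 : new_edges J s u = set0.
  apply/setP => e; rewrite !inE (_ : (_ + s.+1 == r)%N = false) ?andbF //; lia.
by rewrite eqN N0; do 2!case: ifP.
Qed.

(** Below v, membership in I matters for heavy vertices only, and for these it is
    recorded by the fingerprints. *)
Lemma container_online I J (v : nat) :
  (forall s (u : 'I_n), (s < r)%N -> (u < v)%N ->
     (u \in fingerprint I s) = (u \in fingerprint J s)) ->
  container I :&: initseg n v = container J :&: initseg n v.
Proof.
move=> IJ; have eqf := active_online IJ.
apply/setP => u; rewrite !inE; have [uv|] := ltnP u v; last by rewrite !andbF.
rewrite !andbT.
have eqh s : heavy I s u = heavy J s u.
  by rewrite /heavy !eqf //; apply: ltnW.
under eq_forallb => s do rewrite eqh.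
case: (boolP [forall _, _]); rewrite ?orbT // !orbF.
rewrite negb_forall => /existsP[s]; rewrite negbK => hs.
by have := IJ s u (ltn_ord s) uv; rewrite !inE eqh hs !andbT.
Qed.

End Algorithm.

(** * Degree sums *)

Lemma card_bigcup_le (I T : finType) (P : pred I) (F : I -> {set T}) :
  (#|\bigcup_(i | P i) F i| <= \sum_(i | P i) #|F i|)%N.
Proof.
apply: (big_rec2 (fun (A : {set T}) k => #|A| <= k)%N) => [|i k A _ Ak].
  by rewrite cards0.
by apply: leq_trans (leq_card_setU _ _) _; rewrite leq_add2l.
Qed.

Section Degrees.
Variables (R : realType) (n r : nat) (G : hypergraph 'I_n r).
Implicit Types (S Y : {set 'I_n}) (P : {set {set 'I_n}}).

Definition volume S : R := \sum_(u in S) (deg G u)%:R.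

Definition num_nonisolated : R := \sum_(u : 'I_n) ((0 < deg G u)%N)%:R.

Lemma volume_ge0 S : 0 <= volume S.
Proof. exact: sumr_ge0. Qed.

Lemma volumeU S Y : volume (S :|: Y) <= volume S + volume Y.
Proof.
rewrite /volume !(big_mkcond (fun u => u \in _)) -big_split /=.
apply: ler_sum => u _; rewrite inE.
by case: (u \in S); case: (u \in Y) => /=; rewrite ?addr0 ?add0r // lerDl.
Qed.

Lemma volume_bigcup (I : finType) (F : I -> {set 'I_n}) :
  volume (\bigcup_i F i) <= \sum_i volume (F i).
Proof.
apply: (big_rec2 (fun A x => volume A <= x)) => [|i x A _ Ax].
  by rewrite /volume big_set0.
by apply: le_trans (volumeU _ _) _; rewrite lerD2l.
Qed.

Lemma volumeS S Y : S \subset Y -> volume S <= volume Y.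
Proof.
move=> /subsetP SY; rewrite /volume [leLHS]big_mkcond [leRHS]big_mkcond.
apply: ler_sum => u _; case: ifP => [/SY->//|_]; by case: ifP.
Qed.

Lemma volumeC S : volume (~: S) = volume setT - volume S.
Proof.
by rewrite /volume [\sum_(u in [set: _]) _](big_setID S) /= setTI setTD addrAC subrr add0r.
Qed.

Lemma sum_tail_deg P s Y :
  (\sum_(u in Y) tail_deg P s u = \sum_(e in P) #|tail s e :&: Y|)%N.
Proof.
under eq_bigr do rewrite /tail_deg -sum1_card big_mkcond /=.
rewrite exchange_big [RHS]big_mkcond /=; apply: eq_big => [//|e _].
case: ifP => eP; last by rewrite big1 // => u _; rewrite inE eP.
rewrite -sum1_card [LHS]big_mkcond [RHS]big_mkcond /=.
apply: eq_bigr => u _; rewrite !inE eP /=.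
by case: (u \in Y); rewrite ?andbF ?andbT.
Qed.

Lemma deg_tail_deg u : deg G u = tail_deg (edges G) r u.
Proof.
apply: eq_card => e; rewrite !inE sub1set; case eG: (e \in edges G) => //=.
by rewrite -(edges_card eG) leq_addl andbT.
Qed.

Lemma tail_degU (P Q : {set {set 'I_n}}) s u :
  (tail_deg (P :|: Q) s u <= tail_deg P s u + tail_deg Q s u)%N.
Proof.
apply: leq_trans (leq_card_setU _ _); apply: subset_leq_card.
by apply/subsetP => e; rewrite !inE andb_orl.
Qed.

Lemma tail_degS (P Q : {set {set 'I_n}}) s u : P \subset Q -> (tail_deg P s u <= tail_deg Q s u)%N.
Proof.
move=> /subsetP PQ; apply: subset_leq_card.
by apply/subsetP => e; rewrite !inE => /andP[/PQ->].
Qed.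

Lemma tail_deg_le_deg (P : {set {set 'I_n}}) s u : P \subset edges G -> (tail_deg P s u <= deg G u)%N.
Proof.
move=> /subsetP PG; apply: subset_leq_card; apply/subsetP => e.
by rewrite !inE sub1set => /andP[/PG-> /andP[]].
Qed.

Lemma volumeT : volume setT = r%:R * (num_edges G)%:R.
Proof.
rewrite /volume -natr_sum -natrM; congr _%:R.
under eq_bigr do rewrite deg_tail_deg.
rewrite sum_tail_deg (eq_bigr (fun=> r)); last first.
  by move=> e eG; rewrite setIT card_tail ?(edges_card eG).
by rewrite sum_nat_const mulnC.
Qed.

Hypothesis vertT : vertices G = [set: 'I_n].

Lemma avg_degE : avg_deg R G = volume setT / n%:R.
Proof.
by rewrite /avg_deg /num_vertices /volume vertT cardsT card_ord.
Qed.

Lemma deg_measureE S : (0 < n)%N -> deg_measure R G S = volume S / volume setT.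
Proof.
move=> n0; rewrite /deg_measure avg_degE /num_vertices vertT cardsT card_ord.
by rewrite mulrCA divff ?mulr1 1?mulrC // pnatr_eq0 -lt0n.
Qed.

(** Simplicity enters here: all edges counted contain both v and u. *)
Lemma card_edges_through2 P s u (v : 'I_n) :
  simple_graph G -> P \subset edges G -> (forall e, e \in P -> v \in e /\ (rank e v + s.+1 = r)%N) ->
  (tail_deg P s u <= 1)%N.
Proof.
move=> simpleG /subsetP PG Pv.
have [->//|/card_gt0P[e0]] := posnP (tail_deg P s u).
rewrite inE => /andP[e0P]; rewrite inE (edges_card (PG _ e0P)) => /andP[u0 ru].
have vu : v != u.
  by apply/eqP => vu; have [_] := Pv _ e0P; rewrite vu; lia.
have := simpleG v u; rewrite vertT !inE => /(_ isT isT vu); apply: leq_trans.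
apply: subset_leq_card; apply/subsetP => e; rewrite !inE => /andP[eP /andP[ue _]].
by rewrite PG //= subUset !sub1set ue (Pv _ eP).1.
Qed.

Lemma deltaj_ge0 (tau : R) j : 0 < tau -> 0 <= deltaj G tau j.
Proof.
move=> tau0; rewrite /deltaj avg_degE; apply: divr_ge0.
  by apply: sumr_ge0.
by rewrite !mulr_ge0 ?exprn_ge0 ?invr_ge0 ?volume_ge0 // ltW.
Qed.

(** In codeg_fun the term j = r alone suffices: its coefficient 2^(r-2) is at
    least 1, and an edge through v witnesses that its r-th co-degree is
    positive. *)
Lemma num_nonisolated_le (zeta tau : R) :
  (1 < r)%N -> (0 < n)%N -> 0 < tau -> 0 < volume setT -> codeg_fun G tau <= zeta ->
  num_nonisolated <= zeta * tau ^+ r.-1 * volume setT.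
Proof.
move=> r1 n0 tau0 D0 hd.
have D'0 : 0 < tau ^+ r.-1 * volume setT by rewrite mulr_gt0 ?exprn_gt0.
rewrite -mulrA -ler_pdivrMr //; apply: le_trans hd.
apply: (@le_trans _ _ (deltaj G tau r)).
  rewrite /deltaj avg_degE /num_vertices vertT cardsT card_ord.
  rewrite -[X in _ / X]mulrA [n%:R * _]mulrC divfK ?pnatr_eq0 -?lt0n //.
  rewrite ler_pdivrMr // divfK ?gt_eqF //.
  rewrite [leRHS]big_mkcond; apply: ler_sum => u _; rewrite inE ler_nat.
  case: posnP => // /card_gt0P[e]; rewrite inE sub1set => /andP[eG ue].
  have Pe : [&& e \subset vertices G, u \in e & #|e| == r].
    by rewrite edges_sub // ue (edges_card eG) eqxx.
  rewrite /codegj; apply: leq_trans (leq_bigmax_cond (F := codeg G) e Pe).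
  by apply/card_gt0P; exists e; rewrite inE eG /=.
rewrite /codeg_fun big_nat_recr //= mulrDr.
rewrite -[leLHS]add0r; apply: lerD.
  rewrite mulr_ge0 ?exprz_ge0 // sumr_ge0 // => j _.
  by rewrite mulr_ge0 ?deltaj_ge0 // invr_ge0 exprn_ge0.
rewrite mulrA -[leLHS]mul1r; apply: ler_wpM2r; first exact: deltaj_ge0.
rewrite exprnN -expfzDr ?pnatr_eq0 // -[leLHS](expr0z 2) ler_weXz2l ?ler1n //.
have -> : ('C(r, 2) = r.-1 + 'C(r.-1, 2))%N.
  by case: (r) r1 => // m _; rewrite binS bin1 addnC.
lia.
Qed.

End Degrees.

(** * Measures of fingerprints and containers *)

Section Bounds.
Variables (R : realType) (n r : nat) (G : hypergraph 'I_n r) (zeta tau : R).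
Implicit Types (S I : {set 'I_n}).
Hypotheses (n_gt0 : (0 < n)%N) (r_gt0 : (0 < r)%N)
  (vertT : vertices G = [set: 'I_n]) (simpleG : simple_graph G)
  (zeta_gt0 : 0 < zeta) (tau_gt0 : 0 < tau).

Local Notation D := (volume R G setT).
Local Notation vol := (volume R G).
Local Notation active := (active G zeta tau).
Local Notation new_edges := (new_edges G zeta tau).
Local Notation heavy := (heavy G zeta tau).
Local Notation saturated := (saturated G tau).
Local Notation fingerprint := (fingerprint G zeta tau).
Local Notation container := (container G zeta tau).
Local Notation threshold := (threshold r zeta tau).

Lemma threshold_gt0 s : 0 < threshold s.
Proof. by rewrite mulr_gt0 ?exprn_gt0 //; case: eqP. Qed.

(** Scanning one vertex raises the degree of u by at most 1, and only as long as u
    is unsaturated. *)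
Lemma tail_deg_active_le I m s u : (0 < s <= r)%N -> (m <= n)%N ->
  (tail_deg (active I m s) s u)%:R <=
  tau ^+ (r - s) * (deg G u)%:R + (0 < deg G u)%N%:R.
Proof.
move=> /andP[s_gt0]; rewrite leq_eqVlt => /orP[/eqP->|sr] mn.
  by rewrite active_top -deg_tail_deg subnn mul1r lerDl.
elim: m mn => [|m IH] mn.
  rewrite /= ltn_eqF // /tail_deg eq_card0 => [|e]; last by rewrite !inE.
  by rewrite addr_ge0 // mulr_ge0 ?exprn_ge0 // ltW.
pose v : 'I_n := Ordinal mn.
rewrite -[m.+1]/(val v).+1 active_succ; case: ifP => _; last first.
  by rewrite setU0 IH // ltnW.
have NG : new_edges I s v \subset edges G.
  by apply/subsetP => e; rewrite inE => /andP[/(subsetP (active_sub_edges _ _ _ _ _ _))].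
apply: le_trans (_ : ((tail_deg (active I v s) s u)%:R +
                      (tail_deg (new_edges I s v) s u)%:R) <= _).
  by rewrite -natrD ler_nat tail_degU.
have [N0|/card_gt0P[e]] := posnP (tail_deg (new_edges I s v) s u).
  by rewrite N0 addr0 IH // ltnW.
rewrite inE => /andP[eN ue].
have dpos : (0 < deg G u)%N.
  by apply: leq_trans (tail_deg_le_deg s u NG); apply/card_gt0P; exists e; rewrite inE eN.
rewrite dpos; apply: lerD.
  move: eN; rewrite inE => /and4P[_ _ _ /forall_inP/(_ u ue)].
  by rewrite -ltNge => /ltW.
rewrite lern1; apply: (card_edges_through2 vertT u (v := v) simpleG NG) => e'.
by rewrite inE => /and4P[_ -> /eqP].
Qed.

Lemma sum_tail_deg_active_le I s (Y : {set 'I_n}) : (0 < s <= r)%N ->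
  \sum_(u in Y) (tail_deg (active I n s) s u)%:R <=
  tau ^+ (r - s) * vol Y + num_nonisolated R G.
Proof.
move=> sr; rewrite mulr_sumr.
apply: le_trans (_ : _ <= \sum_(u in Y) (tau ^+ (r - s) * (deg G u)%:R + (0 < deg G u)%N%:R)) _.
  by apply: ler_sum => u _; apply: tail_deg_active_le.
rewrite big_split lerD2l /num_nonisolated [leLHS]big_mkcond.
by apply: ler_sum => u _; case: ifP.
Qed.

Lemma fingerprint_volume I s : (s < r)%N ->
  threshold s * vol (fingerprint I s) <= #|active I n s|%:R.
Proof.
move=> sr; apply: le_trans (_ : (\sum_(v in fingerprint I s) #|new_edges I s v|)%:R <= _).
  rewrite natr_sum mulr_sumr; apply: ler_sum => v.
  by rewrite inE => /andP[_ /andP[]].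
by rewrite ler_nat sum_new_edges_le.
Qed.

Hypotheses (zeta_le : zeta <= 1 / 12) (rtau_le : r%:R * tau <= zeta ^+ 2).
Hypothesis nonisolated_le : (1 < r)%N ->
  num_nonisolated R G <= zeta * tau ^+ r.-1 * D.

Fact tau_le_sqr : tau <= zeta ^+ 2.
Proof. by apply: le_trans rtau_le; rewrite ler_peMl ?ler1n // ltW. Qed.

Lemma tau_le1 : tau <= 1.
Proof. by apply: le_trans tau_le_sqr _; move: zeta_gt0 zeta_le; nra. Qed.

Lemma nonisolated_le_level s : (1 < r)%N -> (0 < s)%N ->
  num_nonisolated R G <= zeta * tau ^+ (r - s) * D.
Proof.
move=> r1 s0; apply: le_trans (nonisolated_le r1) _.
apply: ler_wpM2r; first exact: volume_ge0.
apply: ler_wpM2l; first exact: ltW.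
apply: ler_wiXn2l; [exact: ltW|exact: tau_le1|lia].
Qed.

(** Double counting of the edges of P_s: each has s tail vertices, and each vertex
    of T_s brings zeta tau^(r-s-1) d(v) of them. *)
Lemma fingerprint_volume_pos I s : (0 < s < r)%N ->
  vol (fingerprint I s) <= 2 * tau / zeta * D.
Proof.
move=> /andP[s0 sr].
have := sum_tail_deg_active_le I setT (ltac:(lia) : (0 < s <= r)%N).
rewrite -natr_sum sum_tail_deg.
have -> : (\sum_(e in active I n s) #|tail s e :&: [set: 'I_n]| = #|active I n s| * s)%N.
  rewrite -sum_nat_const; apply: eq_bigr => e /card_active ec.
  by rewrite setIT card_tail // ec ltnW.
have := fingerprint_volume I sr.
have := nonisolated_le_level (ltac:(lia)) s0.
rewrite /threshold gtn_eqF // (_ : r - s = (r - s.+1).+1)%N; last by lia.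
rewrite exprS natrM; set x := tau ^+ _.
have x0 : 0 < x by rewrite exprn_gt0.
have s1 : 1 <= s%:R :> R by rewrite ler1n.
have V0 := volume_ge0 R G (fingerprint I s).
have D0 := volume_ge0 R G setT.
set V := vol (fingerprint _ _); set f : R := #|active _ _ _|%:R; set N := num_nonisolated _ _.
move=> H1 H2 H3.
have f0 : 0 <= f by rewrite ler0n.
have H4 : zeta * V <= tau * (1 + zeta) * D.
  rewrite -(ler_pM2l x0); apply: (@le_trans _ _ f); first by move: H2; lra.
  apply: (@le_trans _ _ (f * s%:R)); first by rewrite ler_peMr.
  by move: H1 H3; lra.
rewrite (_ : _ * D = tau * 2 * D / zeta); last by ring.
rewrite ler_pdivlMr // mulrC; apply: le_trans H4 _.
apply: ler_wpM2r => //; apply: ler_wpM2l; first exact: ltW.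
by move: zeta_le; lra.
Qed.

Definition light_set : {set 'I_n} :=
  [set v | (deg G v)%:R < zeta * avg_deg R G].

Definition heavy_set I : {set 'I_n} := [set v | [exists s : 'I_r, heavy I s v]].

(** The set Z of the introduction. *)
Definition exceptional I : {set 'I_n} := light_set :|: heavy_set I.

Definition saturated_set I s : {set 'I_n} :=
  [set u | saturated (active I n s) s u].

Definition tail_cover I s := exceptional I :|: saturated_set I s.

Lemma volume_light_set : vol light_set <= zeta * D.
Proof.
apply: (@le_trans _ _ (\sum_(v in light_set) zeta * avg_deg R G)).
  by apply: ler_sum => v; rewrite inE => /ltW.
rewrite sumr_const avg_degE // -[leLHS]mulr_natr.
rewrite -mulrA [_ / _ * _]mulrC mulrA [zeta * _]mulrC -!mulrA.
have D0 := volume_ge0 R G setT.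
have : #|light_set|%:R / n%:R <= 1 :> R.
  by rewrite ler_pdivrMr ?ltr0n // mul1r ler_nat -[n in (_ <= n)%N]card_ord max_card.
have : 0 <= #|light_set|%:R / n%:R :> R by rewrite divr_ge0.
move: zeta_gt0; set q := _ / n%:R.
have -> : #|light_set|%:R * (zeta * (D / n%:R)) = q * (zeta * D) by rewrite /q; ring.
move=> z0 q0 q1; rewrite [leRHS](_ : _ = 1 * (zeta * D)); last by rewrite mul1r.
by apply: ler_wpM2r => //; rewrite mulr_ge0 // ltW.
Qed.

(** A heavy vertex is either thrown out of the container or put in a
    fingerprint. *)
Lemma heavy_set_subset I :
  heavy_set I \subset ~: container I :|: \bigcup_(s < r) fingerprint I s.
Proof.
apply/subsetP => v; rewrite !inE => /existsP[s hs].
have [vI|vI] := boolP (v \in I).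
  by apply/orP; right; apply/bigcupP; exists s; rewrite // inE vI.
by rewrite /= negb_forall; apply/orP; left; apply/existsP; exists s; rewrite negbK.
Qed.

(** Take an edge of P_(s+1) whose tail misses Z and U_s.  It belongs to the link of
    its first tail vertex v, because none of its later vertices is saturated; as
    v is neither heavy nor of small degree, this link is below the threshold.
    The thresholds add up to zeta tau^(r-s-1) times the degree sum. *)
Lemma uncovered_edges I s : (0 < s < r)%N ->
  #|[set e in active I n s.+1 | [disjoint tail s.+1 e & tail_cover I s]]|%:R <=
  zeta * tau ^+ (r - s.+1) * D.
Proof.
move=> /andP[s0 sr].
pose small v := #|new_edges I s v|%:R < threshold s * (deg G v)%:R.
apply: (@le_trans _ _ (#|\bigcup_(v | small v) new_edges I s v|%:R)).
  rewrite ler_nat; apply: subset_leq_card; apply/subsetP => e.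
  rewrite inE => /andP[eF dis]; have ec := card_active eF.
  have [v ve rk] := exists_rank (ltac:(lia) : (r - s.+1 < #|e|)%N).
  have eFv : e \in active I v s.+1 by apply: active_at_head eF ve _; lia.
  have notC u : u \in tail s.+1 e -> u \notin tail_cover I s.
    by move=> ue; rewrite (disjointFr dis ue).
  have eN : e \in new_edges I s v.
    rewrite inE eFv ve /= (_ : _ == r); last by apply/eqP; lia.
    apply/forall_inP => u; rewrite inE => /andP[ue rku].
    have ut : u \in tail s.+1 e by rewrite inE ue; lia.
    have := notC u ut; rewrite !inE !negb_or => /andP[_].
    apply: contraNN => /le_trans; apply; rewrite ler_nat; apply: tail_degS.
    by apply: active_mono; apply: ltnW.
  apply/bigcupP; exists v => //; rewrite /small ltNge; apply/negP => big.
  have vt : v \in tail s.+1 e by rewrite inE ve; lia.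
  have := notC v vt; rewrite !inE !negb_or -leNgt => /andP[/andP[lv]] /existsP[].
  by exists (Ordinal sr); rewrite /heavy /heavy_link lv.
apply: (@le_trans _ _ (\sum_(v | small v) threshold s * (deg G v)%:R)).
  apply: (@le_trans _ _ (\sum_(v | small v) #|new_edges I s v|)%:R).
    by rewrite ler_nat card_bigcup_le.
  by rewrite natr_sum; apply: ler_sum => v /ltW.
rewrite -mulr_sumr /threshold gtn_eqF //; apply: ler_wpM2l.
  by rewrite mulr_ge0 ?exprn_ge0 // ltW.
rewrite /volume [leLHS]big_mkcond [leRHS]big_mkcond; apply: ler_sum => v _.
by rewrite inE; case: ifP.
Qed.

(** For s = 1 every active edge whose tail is {u} lies in the level 0 link of u,
    so a saturated u of large enough degree is heavy. *)
Lemma volume_cover1 I : vol (tail_cover I 1) <= vol (exceptional I).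
Proof.
apply: volumeS; rewrite subUset subxx /=; apply/subsetP => u.
rewrite !inE => sat; have [//|du] := ltP (deg G u)%:R (zeta * avg_deg R G).
apply/existsP; exists (Ordinal r_gt0); rewrite /heavy /heavy_link du /=.
rewrite /threshold mul1r; apply: le_trans sat _; rewrite ler_nat.
apply: subset_leq_card; apply/subsetP => e; rewrite !inE => /and3P[eF ue ru].
have ec := card_active eF; have := rank_lt_card ue; rewrite ec => rku.
rewrite ec in ru; rewrite (active_at_head eF ue) ?ue /=; last by lia.
rewrite (_ : _ == r) /=; last by apply/eqP; lia.
apply/forall_inP => w; rewrite inE ec => /andP[/rank_lt_card]; rewrite ec; lia.
Qed.

(** The set Y meets the tail of all but few edges of P_(s+1), and a tail that it
    meets has at most s vertices outside Y.  So the degrees outside Y sum to at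
    most s times the degrees in Y, up to a small error; comparing with the
    saturation degree bounds the part of U_(s+1) outside Y. *)
Lemma volume_cover_succ I s : (0 < s < r)%N ->
  vol (tail_cover I s.+1) <= s.+1%:R * vol (tail_cover I s) + (2 * s%:R + 1) * zeta * D.
Proof.
move=> sr; pose Y := tail_cover I s; pose P := active I n s.+1.
pose L := [set e in P | [disjoint tail s.+1 e & Y]].
(* Edge by edge: a tail has s + 1 vertices, at least one of them in Y unless the
   edge is in L. *)
have edge : (\sum_(u in ~: Y) tail_deg P s.+1 u <=
    s * \sum_(u in Y) tail_deg P s.+1 u + s.+1 * #|L|)%N.
  rewrite !sum_tail_deg mulnC -sum1_card !big_distrl /=.
  rewrite [X in (_ <= _ + X)%N](_ : _ =
    \sum_(e in P) if [disjoint tail s.+1 e & Y] then s.+1 else 0)%N; last first.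
    rewrite mulnC big_distrl /= big_mkcond [RHS]big_mkcond; apply: eq_bigr => e _.
    by rewrite !inE; case: (e \in P) => //=; rewrite mul1n.
  rewrite -big_split /=; apply: leq_sum => e /card_active ec.
  have := cardsID Y (tail s.+1 e); rewrite -setDE card_tail ?ec; last by lia.
  rewrite -setI_eq0 -cards_eq0.
  move: #|_ :&: _| #|_ :\: _| => a b; case: eqP; nia.
set k := (r - s.+1)%N; pose x := tau ^+ k.
have x0 : 0 < x by rewrite exprn_gt0.
have HL : #|L|%:R <= zeta * x * D by apply: uncovered_edges.
have HY := sum_tail_deg_active_le I Y (ltac:(lia) : (0 < s.+1 <= r)%N).
have HN := nonisolated_le_level (ltac:(lia)) (ltn0Sn s).
have HU : x * vol (saturated_set I s.+1 :\: Y) <=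
          (\sum_(u in ~: Y) tail_deg P s.+1 u)%:R.
  rewrite natr_sum mulr_sumr [leLHS]big_mkcond [leRHS]big_mkcond.
  apply: ler_sum => u _; rewrite !inE; case: (_ || _) => //=.
  by case: ifP.
have H : vol (saturated_set I s.+1 :\: Y) <=
         s%:R * (vol Y + zeta * D) + s.+1%:R * (zeta * D).
  rewrite -(ler_pM2l x0); apply: le_trans HU _.
  have {}edge : (\sum_(u in ~: Y) tail_deg P s.+1 u)%:R <=
    s%:R * (\sum_(u in Y) tail_deg P s.+1 u)%:R + s.+1%:R * #|L|%:R :> R.
    by rewrite -!natrM -natrD ler_nat.
  apply: le_trans edge _; rewrite mulrDr; apply: lerD.
    rewrite mulrCA; apply: ler_wpM2l => //; rewrite natr_sum.
    by apply: le_trans HY _; rewrite mulrDr lerD2l; apply: le_trans HN _; rewrite /x; lra.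
  by rewrite mulrCA; apply: ler_wpM2l => //; apply: le_trans HL _; lra.
apply: (@le_trans _ _ (vol (Y :|: (saturated_set I s.+1 :\: Y)))).
  apply: volumeS; apply/subsetP => u; rewrite !inE.
  by case: (_ < _) => //=; case: [exists _, _] => //=; case: (saturated _ s u).
apply: le_trans (volumeU _ _ _ _) _; rewrite -/Y.
by move: H; rewrite -natr1; lra.
Qed.

(** The constant 3 (s! - 1) is a closed form that absorbs the error 2 s + 1 of
    each step of the recursion. *)
Lemma volume_cover_le I s : (0 < s <= r)%N ->
  vol (tail_cover I s) <= s`!%:R * vol (exceptional I) + 3 * (s`!%:R - 1) * zeta * D.
Proof.
have zD : 0 <= zeta * D by rewrite mulr_ge0 ?volume_ge0 // ltW.
elim: s => [//|[|s] IH] sr.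
  have -> : 1`!%:R = 1 :> R by [].
  by rewrite mul1r subrr mulr0 !mul0r addr0 volume_cover1.
have {}IH := IH (ltac:(lia)); have {}sr : (0 < s.+1 < r)%N by lia.
apply: le_trans (volume_cover_succ _ sr) _.
rewrite [s.+2`!]factS natrM.
apply: (@le_trans _ _ (s.+2%:R * (s.+1`!%:R * vol (exceptional I) +
   3 * (s.+1`!%:R - 1) * zeta * D) + (2 * s.+1%:R + 1) * zeta * D)).
  by rewrite lerD2r; apply: ler_wpM2l.
have s0 : 0 <= s%:R :> R by [].
rewrite -[s.+2%:R]natr1 -[s.+1%:R]natr1; set q : R := s%:R in s0 *.
have : 0 <= q * (zeta * D) by rewrite mulr_ge0.
by lra.
Qed.

(** At level r all edges are active and every vertex counts as saturated. *)
Lemma volume_exceptional I : D <= r`!%:R * (vol (exceptional I) + 3 * zeta * D).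
Proof.
have E : vol (tail_cover I r) = D.
  congr volume; apply/setP => u; rewrite !inE; apply/orP; right.
  by rewrite /saturated active_top -deg_tail_deg subnn mul1r.
have := volume_cover_le I (ltac:(lia) : (0 < r <= r)%N); rewrite E.
have : 0 <= zeta * D by rewrite mulr_ge0 ?volume_ge0 // ltW.
by lra.
Qed.

(** Containers are collected over all sets with this property, a decidable form of
    the hypotheses on I. *)
Definition small_fingerprint (I : {set 'I_n}) : bool :=
  [forall s : 'I_r, vol (fingerprint I s) <= 2 * tau / zeta * D].

Lemma small_fingerprint0 I :
  vol (fingerprint I 0) <= 2 * tau / zeta * D -> small_fingerprint I.
Proof.
move=> H0; apply/forallP => -[[|s] sr] //=.
exact: fingerprint_volume_pos.
Qed.

Lemma fingerprint_volume0 I :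
  tau ^+ r.-1 * vol (fingerprint I 0) <=
  #|ind_edges G (\bigcup_(s < r) fingerprint I s)|%:R.
Proof.
have := fingerprint_volume I r_gt0.
rewrite /threshold mul1r subn1 => /le_trans; apply.
rewrite ler_nat; apply: subset_leq_card; apply/subsetP => e eA.
by rewrite inE (subsetP (active_sub_edges _ _ _ _ _ _) _ eA) (active0_sub eA).
Qed.

Lemma fingerprints_sub I : \bigcup_(s < r) fingerprint I s \subset I.
Proof. by apply/bigcupsP => s _; apply: fingerprint_sub. Qed.

Lemma small_fingerprint_sparse I :
  (num_edges (induced G I))%:R <=
    2 * r%:R * tau ^+ r * (num_edges G)%:R / zeta ->
  small_fingerprint I.
Proof.
move=> sparse; apply: small_fingerprint0.
have x0 : 0 < tau ^+ r.-1 by rewrite exprn_gt0.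
rewrite -(ler_pM2l x0); apply: le_trans (fingerprint_volume0 I) _.
apply: le_trans (_ : (num_edges (induced G I))%:R <= _).
  rewrite ler_nat; apply: subset_leq_card; apply/subsetP => e.
  rewrite !inE => /andP[-> /subset_trans]; apply; exact: fingerprints_sub.
apply: le_trans sparse _.
rewrite volumeT (_ : tau ^+ r = tau * tau ^+ r.-1); last by rewrite -exprS prednK.
by rewrite le_eqVlt; apply/orP; left; apply/eqP; ring.
Qed.

(** The edges completed at level 0 are spanned by the union S of the fingerprints,
    so degeneracy bounds tau^(r-1) times the degree sum of T_0 by b |S|.  As all
    fingerprint vertices have degree at least zeta d, b |S| is at most
    tau^(r-1) / r times the degree sum of all fingerprints, T_0 included; T_0
    itself accounts for a fraction 1/r only, and can be moved to the left.  For
    r = 1 this gives nothing, but then the floor is 0. *)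
Lemma small_fingerprint_degenerate I :
  degenerate (induced G I)
    ((Num.floor (tau ^+ r.-1 * zeta * (num_edges G)%:R / n%:R))%:~R : R) ->
  small_fingerprint I.
Proof.
move=> degen; apply: small_fingerprint0; set T := fun s => vol (fingerprint I s).
set b : R := (Num.floor _)%:~R in degen.
pose S := \bigcup_(s < r) fingerprint I s.
have nR : 0 < n%:R :> R by rewrite ltr0n.
have x0 : 0 < tau ^+ r.-1 by rewrite exprn_gt0.
have SI : S \subset I := fingerprints_sub I.
have D0 : 0 <= D := volume_ge0 R G setT.
have main : tau ^+ r.-1 * T 0%N <= b * #|S|%:R.
  apply: le_trans (fingerprint_volume0 I) _; apply: le_trans (degen S _).
    rewrite ler_nat; apply: subset_leq_card; apply/subsetP => e.
    by rewrite !inE => /andP[-> eS]; rewrite eS (subset_trans eS SI).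
  by rewrite /= vertT setTI.
have rhs0 : 0 <= 2 * tau / zeta * D.
  by rewrite mulr_ge0 // divr_ge0 ?mulr_ge0 // ltW.
have [r1|r1] := leqP r 1.
  suff b0 : b <= 0.
    apply: le_trans rhs0; rewrite -(ler_pM2l x0) mulr0; apply: le_trans main _.
    by rewrite mulr_le0_ge0.
  rewrite /b lerz0 floor_le0 (_ : r.-1 = 0)%N ?mul1r; last by lia.
  rewrite ltr_pdivrMr // mul1r; apply: (@le_lt_trans _ _ (zeta * n%:R)).
    apply: ler_wpM2l; first exact: ltW.
    rewrite ler_nat /num_edges; apply: leq_trans (_ : #|set1 @: [set: 'I_n]| <= n)%N.
      apply: subset_leq_card; apply/subsetP => e eG.
      have /eqP/cards1P[u ->] : #|e| = 1%N by rewrite (edges_card eG); lia.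
      exact: imset_f.
    by apply: leq_trans (leq_imset_card _ _) _; rewrite cardsT card_ord.
  by rewrite gtr_pMl //; move: zeta_le; lra.
have b_le : b <= tau ^+ r.-1 * zeta * (num_edges G)%:R / n%:R by apply: floor_le.
have rR : 1 < r%:R :> R by rewrite ltr1n.
have r0 : 0 < r%:R :> R by rewrite ltr0n.
have cardT s : zeta * (D / n%:R) * #|fingerprint I s|%:R <= T s.
  rewrite mulrC mulr_natl -sumr_const; apply: ler_sum => v.
  by rewrite inE => /andP[_ /andP[]]; rewrite avg_degE.
have cardS : #|S|%:R <= \sum_(s < r) #|fingerprint I s|%:R :> R.
  by rewrite -natr_sum ler_nat card_bigcup_le.
have sumT : zeta * (D / n%:R) * #|S|%:R <= \sum_(s < r) T s.
  apply: le_trans (_ : \sum_(s < r) zeta * (D / n%:R) * #|fingerprint I s|%:R <= _).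
    rewrite -mulr_sumr; apply: ler_wpM2l => //.
    by rewrite mulr_ge0 ?divr_ge0 // ltW.
  by apply: ler_sum => s _; apply: cardT.
have sumT' : \sum_(s < r) T s <= T 0%N + r.-1%:R * (2 * tau / zeta * D).
  rewrite -(big_mkord xpredT T) big_ltn // lerD2l.
  apply: le_trans (_ : \sum_(1 <= s < r) (2 * tau / zeta * D) <= _).
    by apply: ler_sum_nat => s sr; apply: fingerprint_volume_pos.
  by rewrite sumr_const_nat subn1 -[leLHS]mulr_natl.
have : r%:R * T 0%N <= \sum_(s < r) T s.
  apply: le_trans sumT; rewrite -(ler_pM2l x0).
  apply: le_trans (_ : r%:R * (b * #|S|%:R) <= _).
    by rewrite mulrCA ler_pM2l.
  rewrite mulrA [leRHS]mulrA; apply: ler_wpM2r => //.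
  apply: le_trans (ler_wpM2l (ltW r0) b_le) _.
  by rewrite volumeT le_eqVlt; apply/orP; left; apply/eqP; ring.
move=> /le_trans/(_ sumT').
have -> : r.-1%:R = r%:R - 1 :> R by rewrite -subn1 natrB.
have r1' : 0 < r%:R - 1 :> R by rewrite subr_gt0.
by move=> H; rewrite -/(T 0%N) -(ler_pM2l r1'); move: H; lra.
Qed.

Lemma independent_sparse I : independent G I -> num_edges (induced G I) = 0%N.
Proof.
case=> _ indep; apply: eq_card0 => e; rewrite inE.
by apply/negP => /andP[/indep/negP].
Qed.

(** The loss 6 zeta is made of 3 zeta from [volume_exceptional], zeta for the
    vertices of small degree, and 2 r tau / zeta <= 2 zeta for the
    fingerprints. *)
Lemma volume_container I : small_fingerprint I ->
  vol (container I) <= (1 - 1 / r`!%:R + 6 * zeta) * D.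
Proof.
move=> /forallP small.
have D0 : 0 <= D := volume_ge0 R G setT.
have q0 : 0 < r`!%:R :> R by rewrite ltr0n fact_gt0.
have := volume_exceptional I.
rewrite mulrC -ler_pdivrMr //.
have : vol (exceptional I) <= zeta * D + (D - vol (container I)) + 2 * zeta * D.
  apply: le_trans (volumeU _ _ _ _) _; rewrite -addrA; apply: lerD.
    exact: volume_light_set.
  apply: le_trans (volumeS _ _ (heavy_set_subset _)) _.
  apply: le_trans (volumeU _ _ _ _) _; rewrite -volumeC lerD2l.
  apply: le_trans (volume_bigcup _ _ _) _.
  apply: le_trans (_ : \sum_(s < r) (2 * tau / zeta * D) <= _).
    by apply: ler_sum => s _.
  rewrite sumr_const card_ord -mulr_natr.
  rewrite [leLHS](_ : _ = (2 * (r%:R * tau) / zeta) * D); last by ring.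
  apply: ler_wpM2r => //; rewrite ler_pdivrMr //; move: rtau_le; lra.
set q := r`!%:R; rewrite [D / q](_ : _ = 1 / q * D); last by ring.
lra.
Qed.

End Bounds.

(** * Choosing the initial segment *)

(** The weights d(i) - d(i+1) are nonnegative, and the segments shorter than k
    carry a total weight of at most the degree sum over [k]. *)
Lemma exists_light_prefix (R : realType) (n r : nat) (G : hypergraph 'I_n r)
    (J1 J2 : finType) (A : J1 -> {set 'I_n}) (B : J2 -> {set 'I_n})
    (k : nat) (a b : R) :
  (forall i j : 'I_n, (i <= j)%N -> (deg G j <= deg G i)%N) ->
  (0 < k <= n)%N -> 0 < a -> 0 < b ->
  (\sum_j volume R G (A j)) / a + (\sum_j volume R G (B j)) / b +
    volume R G (initseg n k) < volume R G setT ->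
  exists v, [/\ (k <= v <= n)%N,
    \sum_j #|A j :&: initseg n v|%:R <= a * v%:R &
    \sum_j #|B j :&: initseg n v|%:R <= b * v%:R].
Proof.
move=> decr /andP[k0 kn] a0 b0 lt.
pose F i : R := oapp (fun u : 'I_n => (deg G u)%:R) 0 (insub i).
have Fn : F n = 0 by rewrite /F insubF // ltnn.
have FE (u : 'I_n) : (deg G u)%:R = F u by rewrite /F valK.
have volE S : volume R G S =
    \sum_(0 <= i < n) (F i - F i.+1) * #|S :&: initseg n i.+1|%:R.
  by rewrite -(sum_by_parts_initseg S Fn); apply: eq_bigr => u _.
have w0 i : (i < n)%N -> 0 <= F i - F i.+1.
  move=> lin; rewrite subr_ge0 -[i]/(val (Ordinal lin)) -FE.
  have [lin1|] := ltnP i.+1 n.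
    by rewrite -[i.+1]/(val (Ordinal lin1)) -FE ler_nat decr.
  by rewrite leqNgt /F => /negbTE ni; rewrite insubF.
have volT : volume R G setT = \sum_(0 <= i < n) (F i - F i.+1) * i.+1%:R.
  by rewrite volE; apply: eq_big_nat => i /andP[_ lin]; rewrite setTI card_initseg.
pose h (J : finType) (X : J -> {set 'I_n}) i : R := \sum_j #|X j :&: initseg n i.+1|%:R.
have sum_h (J : finType) (X : J -> {set 'I_n}) :
    \sum_j volume R G (X j) = \sum_(0 <= i < n) (F i - F i.+1) * h J X i.
  under eq_bigr do rewrite volE.
  by rewrite exchange_big; apply: eq_bigr => i _; rewrite -mulr_sumr.
have [||i [/andP[ki lin] hA hB]] :=
  @exists_light_index R k.-1 n (fun i => F i - F i.+1) (h J1 A) (h J2 B) a b a0 b0.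
- by move=> i lin; split; [exact: w0 | exact: sumr_ge0 | exact: sumr_ge0].
- under eq_bigr do rewrite mulrDr !mulrA.
  rewrite big_split /= -!mulr_suml -!sum_h.
  apply: lt_le_trans (_ : volume R G setT - volume R G (initseg n k) <= _).
    by rewrite ltrBrDr.
  rewrite volT (big_cat_nat (n := k.-1)) //=; last by lia.
  rewrite lerBlDr addrC lerD2l volE.
  rewrite [leRHS](big_cat_nat (n := k.-1)) //=; last by lia.
  rewrite -[leLHS]addr0; apply: lerD.
    apply: ler_sum_nat => i /andP[_ ik].
    rewrite (setIidPr _) ?card_initseg //; first by lia.
    by apply/subsetP => u; rewrite !inE; lia.
  rewrite big_nat sumr_ge0 // => i /andP[_ lin].
  by rewrite mulr_ge0 // w0.
by exists i.+1; split => //; lia.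
Qed.

(** * The theorem *)

Theorem theorem3p7 (R : realType) (r n : nat) (hr : (0 < r)%N)
  (G : hypergraph 'I_n r) (hV : vertices G = [set: 'I_n])
  (hsimple : simple_graph G) (hedge : (0 < num_edges G)%N)
  (hdecr : forall i j : 'I_n, (i <= j)%N -> (deg G j <= deg G i)%N)
  (zeta tau : R) (hzeta0 : 0 < zeta) (hzeta : zeta <= 1 / (12 * (r`!)%:R))
  (htau0 : 0 < tau) (hdelta : codeg_fun G tau <= zeta)
  (htau : tau <= zeta ^+ 2 / r%:R)
  (k : nat) (hk1 : (1 <= k)%N) (hkn : (k <= n)%N)
  (hmu : deg_measure R G (initseg n k) <= zeta / (2 * (r`!)%:R))
  (t : nat) (ht : (0 < t)%N) :
  exists (C : {set {set 'I_n}}) (g : t.-tuple {set 'I_n} -> nat),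
    (forall Cs : t.-tuple {set 'I_n}, in_power C Cs -> (k <= g Cs <= n)%N) /\
    (forall I : {set 'I_n}, independent G I ->
       exists2 D : {set 'I_n}, D \in C & I \subset D) /\
    (forall v : nat, (1 <= v <= n)%N ->
       (lne ((#|traces C g v|)%:R : R)%:E <=
        (r%:R * zeta ^- 2 * v%:R * t%:R * tau * ln (1 / tau))%:E)%E) /\
    (forall Cs : t.-tuple {set 'I_n}, in_power C Cs ->
       let v := g Cs in
       t%:R^-1 * \sum_(i < t) (#|tnth Cs i :&: initseg n v|)%:R <=
       (1 - 1 / (r`!)%:R + 8 * zeta) * v%:R :> R) /\
    (forall I : {set 'I_n},
       degenerate (induced G I)
         ((Num.floor (tau ^+ r.-1 * zeta * (num_edges G)%:R / n%:R))%:~R : R) \/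
       (num_edges (induced G I))%:R <=
         2 * r%:R * tau ^+ r * (num_edges G)%:R / zeta ->
       exists2 D : {set 'I_n}, D \in C & I \subset D).
Proof.
have n0 : (0 < n)%N by lia.
have rR : 1 <= r%:R :> R by rewrite ler1n.
have r0 : 0 < r%:R :> R by rewrite ltr0n.
have tR : 0 < t%:R :> R by rewrite ltr0n.
have qR : 1 <= r`!%:R :> R by rewrite ler1n fact_gt0.
set q : R := r`!%:R in hzeta hmu qR *.
have q0 : 0 < q by lra.
have qi : q * (1 / q) = 1 by rewrite mulrCA divff ?mulr1 // gt_eqF.
have zq : 12 * zeta * q <= 1.
  by move: hzeta; rewrite ler_pdivlMr ?mulr_gt0 //; lra.
have z12 : zeta <= 1 / 12 by nra.
have rtau : r%:R * tau <= zeta ^+ 2 by rewrite mulrC -ler_pdivlMr.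
have tauz : tau <= zeta ^+ 2 by nra.
have D0 : 0 < volume R G setT by rewrite volumeT mulr_gt0 ?ltr0n.
have noniso : (1 < r)%N ->
    num_nonisolated R G <= zeta * tau ^+ r.-1 * volume R G setT.
  by move=> r1; apply: num_nonisolated_le.
pose fp := fingerprint G zeta tau.
pose ct := container G zeta tau.
pose small := small_fingerprint G zeta tau.
pose C := [set ct I | I : {set 'I_n} & small I].
have in_C I : small I -> exists2 D : {set 'I_n}, D \in C & I \subset D.
  by move=> sI; exists (ct I); [apply: imset_f; rewrite inE | apply: sub_container].
have sparse I : (num_edges (induced G I))%:R <=
    2 * r%:R * tau ^+ r * (num_edges G)%:R / zeta -> small I.
  exact: small_fingerprint_sparse.
(* A container may come from several sets; fix one source for each, so that a
   tuple of containers determines its fingerprints. *)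
pose src (D : {set 'I_n}) := odflt set0 [pick I | small I && (ct I == D)].
have srcP D : D \in C -> small (src D) /\ ct (src D) = D.
  case/imsetP => I; rewrite inE => sI DE; rewrite /src.
  case: pickP => [I' /andP[sI' /eqP cI']//|/(_ I)].
  by rewrite sI DE eqxx.
pose T (Cs : t.-tuple {set 'I_n}) (x : 'I_t * 'I_r) := fp (src (tnth Cs x.1)) x.2.
pose a := 1 - 1 / q + 8 * zeta.
(* The density allowed to fingerprints on the chosen segment is their degree
   measure 2 tau / zeta divided by 2 zeta, the loss allowed in the averaging. *)
pose x := tau / zeta ^+ 2.
have z2 : 0 < zeta ^+ 2 by rewrite exprn_gt0.
have x0 : 0 < x by rewrite divr_gt0.
have x1 : x <= 1 by rewrite ler_pdivrMr // mul1r.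
have b0 : 0 < r%:R * t%:R * x by apply: mulr_gt0 => //; exact: mulr_gt0.
have a0 : 0 < a by rewrite /a; nra.
pose good (Cs : t.-tuple {set 'I_n}) (v : nat) : bool :=
  [&& (k <= v)%N, (\sum_(i < t) #|tnth Cs i :&: initseg n v|%:R <= a * t%:R * v%:R) &
    (\sum_y #|T Cs y :&: initseg n v|%:R <= r%:R * t%:R * x * v%:R)].
pose g Cs : nat := oapp val k [pick v : 'I_n.+1 | good Cs v].
have gP Cs : in_power C Cs -> good Cs (g Cs) /\ (g Cs <= n)%N.
  move=> /forallP CsC.
  suff [v vn gv] : exists2 v, (v <= n)%N & good Cs v.
    rewrite /g; case: pickP => [w gw | /(_ (Ordinal (vn : (v < n.+1)%N)))] /=.
      by split => //; rewrite -ltnS.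
    by rewrite gv.
  have [||||v [/andP[kv vn] hA hB]] := @exists_light_prefix R n r G 'I_t
    ('I_t * 'I_r)%type (tnth Cs) (T Cs) k (a * t%:R) (r%:R * t%:R * x) hdecr.
  - by rewrite hk1.
  - by rewrite mulr_gt0.
  - exact: b0.
  - have S1 : \sum_(j < t) volume R G (tnth Cs j) <=
        t%:R * ((a - 2 * zeta) * volume R G setT).
      rewrite mulr_natl -[X in _ *+ X]card_ord -sumr_const; apply: ler_sum => j _.
      have [sj {1}<-] := srcP _ (CsC j).
      have := volume_container n0 hr hV hsimple hzeta0 htau0 z12 rtau noniso sj.
      by rewrite (_ : a - 2 * zeta = 1 - 1 / q + 6 * zeta) // /a; ring.
    have S2 : \sum_y volume R G (T Cs y) <=
        r%:R * t%:R * (2 * tau / zeta * volume R G setT).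
      rewrite -natrM mulr_natl -[X in _ *+ X](_ : #|{: 'I_t * 'I_r}| = _); last first.
        by rewrite card_prod !card_ord mulnC.
      rewrite -sumr_const; apply: ler_sum => y _.
      by have [/forallP/(_ y.2)] := srcP _ (CsC y.1).
    have S3 : volume R G (initseg n k) <= zeta / (2 * q) * volume R G setT.
      by move: hmu; rewrite deg_measureE // ler_pdivrMr.
    have {}S1 : (\sum_(j < t) volume R G (tnth Cs j)) / (a * t%:R) <=
        (1 - 2 * zeta / a) * volume R G setT.
      rewrite ler_pdivrMr ?mulr_gt0 //; apply: le_trans S1 _.
      rewrite le_eqVlt; apply/orP; left; apply/eqP; field; exact: lt0r_neq0.
    have {}S2 : (\sum_y volume R G (T Cs y)) / (r%:R * t%:R * x) <=
        2 * zeta * volume R G setT.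
      rewrite ler_pdivrMr //; apply: le_trans S2 _; rewrite /x.
      rewrite le_eqVlt; apply/orP; left; apply/eqP; field; exact: lt0r_neq0.
    (* Rewritten as a (2 + 1 / (2 q)) < 2, which holds since a <= 1 - 1 / (3 q). *)
    have key : zeta / (2 * q) < 2 * zeta / a - 2 * zeta.
      have p0 : 0 < 1 / q by rewrite divr_gt0.
      have a_le : a <= 1 - (1 / q) / 3.
        have : 12 * zeta <= 1 / q by rewrite ler_pdivlMr.
        by rewrite /a; lra.
      rewrite ltrBrDr ltr_pdivlMr //.
      rewrite (_ : zeta / (2 * q) + 2 * zeta = zeta * ((1 / q) / 2 + 2)); last first.
        by field; exact: lt0r_neq0.
      rewrite -[ltLHS]mulrA [ltRHS]mulrC ltr_pM2l //.
      apply: (@le_lt_trans _ _ (((1 / q) / 2 + 2) * (1 - (1 / q) / 3))).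
        by apply: ler_wpM2l => //; lra.
      by move: p0; nra.
    apply: le_lt_trans (lerD (lerD S1 S2) S3) _.
    rewrite -!mulrDl -[ltRHS]mul1r ltr_pM2r //; move: key; lra.
  by exists v => //; rewrite /good kv hA.
exists C, g; split; last split; last split; last split.
- by move=> Cs /gP[/andP[-> _] ->].
- move=> I indep; apply/in_C/sparse; rewrite independent_sparse //.
  by rewrite mulr0n divr_ge0 ?mulr_ge0 ?exprn_ge0 // ltW.
- move=> v /andP[v1 vn]; have [->|tr0] := posnP #|traces C g v|.
    by rewrite le0_lneNy ?leNye.
  rewrite lne_EFin ?ltr0n // lee_fin.
  pose code Cs : {set 'I_t * 'I_r * 'I_n} :=
    [set y | (y.2 \in T Cs y.1) && (y.2 < v)%N].
  pose Dom := [set Cs : t.-tuple {set 'I_n} | in_power C Cs && (g Cs == v)].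
  have le_code : (#|traces C g v| <= #|code @: Dom|)%N.
    apply: card_imset_factor => Cs Cs'; rewrite !inE.
    move=> /andP[/forallP CsC _] /andP[/forallP CsC' _] eqcode.
    apply: eq_from_tnth => i; rewrite !tnth_map.
    rewrite -(srcP _ (CsC i)).2 -(srcP _ (CsC' i)).2.
    apply: container_online => s u sr uv.
    have := congr1 (fun X : {set _} => ((i, Ordinal sr), u) \in X) eqcode.
    by rewrite !inE /= uv !andbT.
  pose W := [set y : 'I_t * 'I_r * 'I_n | (y.2 < v)%N].
  have cardW : #|W| = (t * r * v)%N.
    rewrite (_ : W = setX setT (initseg n v)); last first.
      by apply/setP => -[y u]; rewrite !inE.
    by rewrite cardsX cardsT card_prod !card_ord card_initseg.
  have cardcode0 : (0 < #|code @: Dom|)%N by apply: leq_trans le_code.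
  have light S : S \in code @: Dom -> S \subset W /\ #|S|%:R <= r%:R * t%:R * x * v%:R.
    case/imsetP => Cs; rewrite inE => /andP[CsC /eqP gv] ->; split.
      by apply/subsetP => y; rewrite !inE => /andP[].
    have [/and3P[_ _ +] _] := gP _ CsC; rewrite gv; apply: le_trans.
    rewrite -natr_sum ler_nat.
    under eq_bigr do rewrite -sum1_card.
    rewrite pair_big_dep /= sum1_card; apply: subset_leq_card.
    apply/subsetP => -[y u]; rewrite inE => /andP[yT uv].
    by suff : u \in T Cs y :&: initseg n v by []; apply/setIP; split=> //; rewrite inE.
  apply: le_trans (_ : ln (#|code @: Dom|%:R : R) <= _).
    by rewrite ler_ln ?posrE ?ltr0n // ler_nat.
  apply: le_trans (ln_card_light_sets x0 x1 cardcode0 light) _.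
  have ln_zeta : ln zeta <= - (1 / 2).
    have := @le_ln1Dx R (zeta - 1); rewrite addrCA subrr addr0.
    by move: z12 hzeta0 => ? ? /(_ (ltac:(lra))); lra.
  (* The factor zeta^2 in 1 / x pays for the additive error of the count. *)
  have ln_x : ln (1 / x) + 1 <= ln (1 / tau).
    rewrite !div1r /x invf_div ln_div ?posrE // lnXn // lnV ?posrE //.
    by rewrite [ln zeta *+ 2]mulr2n; move: ln_zeta; lra.
  rewrite cardW !natrM.
  apply: (@le_trans _ _ (r%:R * t%:R * x * v%:R * (ln (1 / x) + 1))).
    by rewrite le_eqVlt; apply/orP; left; apply/eqP; ring.
  apply: le_trans (ler_wpM2l _ ln_x) _.
    by apply: mulr_ge0 => //; exact: ltW.
  by rewrite /x le_eqVlt; apply/orP; left; apply/eqP; ring.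
- move=> Cs /gP[/and3P[_ hA _] _] /=.
  by rewrite mulrC ler_pdivrMr // mulrAC.
- by move=> I [dg|sp]; apply: in_C; [apply: small_fingerprint_degenerate|apply: sparse].
Qed.
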